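(* Let $k\ge 1$ and $n\ge 0$ be integers. Then $$C_k^e(n)=\mathcal{P}_{2,1}(n,k)\qquad\text{and}\qquad C_k^o(n)=\bar{\mathcal{P}}_{2,1}(n,k).$$
   Context: A $k$-color partition of $n$ is a finite multiset of positive integers (parts), each carrying one of the $k$ colors $color(1),\dots,color(k)$, whose sum is $n$; repetitions are allowed. $\mathcal{C}_k(n)$ is the set of all $k$-color partitions of $n$ (so $\sum_{n\ge0}|\mathcal{C}_k(n)|q^n=\prod_{j\ge1}(1-q^j)^{-k}$). $C_k^e(n)$ (resp. $C_k^o(n)$) is the number of partitions in $\mathcal{C}_k(n)$ in which the number of parts in $color(k)$, counted with multiplicity, is even (resp. odd). For $\lambda\in\mathcal{C}_k(n)$, $\mathrm{mex}_{2,1}(\lambda_k)$ is the smallest positive integer $\equiv 1 \pmod 2$ that does not occur as a part in $color(k)$ of $\lambda$. $\mathcal{P}_{2,1}(n,k)$ (resp. $\bar{\mathcal{P}}_{2,1}(n,k)$) is the number of $\lambda\in\mathcal{C}_k(n)$ with $\mathrm{mex}_{2,1}(\lambda_k)\equiv 1\pmod 4$ (resp. $\equiv 3 \pmod 4$). *)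

(* Defs.v *)
From mathcomp Require Import all_boot finmap multiset.

Set Implicit Arguments.
Unset Strict Implicit.
Unset Printing Implicit Defensive.

Local Open Scope fset_scope.
Local Open Scope mset_scope.
Local Open Scope nat_scope.

(* A colored partition is a finite multiset of pairs (part, color); the color
   color(i + 1) is the ordinal i, so that color(k) is the ordinal of value
   k - 1. Coercing a multiset to a sequence lists it with multiplicity. *)
Definition colored_partition (k n : nat) (l : {mset nat * 'I_k}) : bool :=
  all (fun x => 0 < x.1) l && (\sum_(x <- l) x.1 == n).

(* A partition of n has at most n parts, all at most n: this only serves to
   cut the (infinite) type of multisets down to a finite set, as lemma
   colored_partitionsP shows. *)
Definition bounded_msets (k n : nat) : seq {mset nat * 'I_k} :=
  [seq seq_mset [seq (val x.1, x.2) | x <- bseqval s]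
     | s <- enum {: {bseq n of 'I_n.+1 * 'I_k}}].

Definition colored_partitions (k n : nat) : {fset {mset nat * 'I_k}} :=
  [fset l in bounded_msets k n | colored_partition n l].

Lemma colored_partitionsP (k n : nat) (l : {mset nat * 'I_k}) :
  (l \in colored_partitions k n) = colored_partition n l.
Proof.
rewrite !inE /=; case: (boolP (colored_partition n l)); rewrite ?andbF ?andbT //.
case/andP=> /allP l_gt0 /eqP l_sum.
have l_size : size l <= n.
  rewrite -l_sum -sum1_size big_seq [X in _ <= X]big_seq.
  by apply: leq_sum => x /l_gt0.
have l_le x : x \in enum_mset l -> x.1 <= n.
  by move=> xl; rewrite -l_sum (big_rem x xl) /= leq_addr.
have s_size : size [seq (inord x.1 : 'I_n.+1, x.2) | x <- l] <= n.
  by rewrite size_map.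
apply/mapP; exists (Bseq s_size); rewrite ?mem_enum //= -map_comp.
rewrite -[LHS]seq_mset_id; congr seq_mset; rewrite -[LHS]map_id.
by apply/eq_in_map => -[p c] /l_le /= p_le; rewrite inordK.
Qed.

Definition last_color_parts (k : nat) (l : {mset nat * 'I_k}) : seq nat :=
  [seq x.1 | x : nat * 'I_k <- enum_mset l & x.2.+1 == k].

Definition Ce (k n : nat) : nat :=
  #|` [fset l in colored_partitions k n | ~~ odd (size (last_color_parts l))]|.

Definition Co (k n : nat) : nat :=
  #|` [fset l in colored_partitions k n | odd (size (last_color_parts l))]|.

Definition mex21_candidate (s : seq nat) : pred nat :=
  fun m => [&& 0 < m, m == 1 %[mod 2] & m \notin s].

Lemma mex21_exists (s : seq nat) : exists m, mex21_candidate s m.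
Proof.
exists (sumn s).*2.+1; rewrite /mex21_candidate /= eqn_mod_dvd // subn1 /=.
rewrite dvdn2 odd_double /=; apply/negP => /perm_to_rem /perm_sumn /= s_sum.
have : (sumn s).*2 < sumn s by rewrite [ltnRHS]s_sum leq_addr.
by rewrite -addnn ltnNge leq_addr.
Qed.

Definition mex21 (s : seq nat) : nat := ex_minn (mex21_exists s).

Definition P21 (n k : nat) : nat :=
  #|` [fset l in colored_partitions k n
        | mex21 (last_color_parts l) == 1 %[mod 4]]|.

Definition P21bar (n k : nat) : nat :=
  #|` [fset l in colored_partitions k n
        | mex21 (last_color_parts l) == 3 %[mod 4]]|.

(* Main.v *)
(** Write C(q) for the generating function of k-colored partitions and D(q) for
    the one where each partition is weighted by (-1)^(number of parts in
    color(k)). Removing the parts of size 1, ..., N of color(k) one size at a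
    time gives [D prod_(i <= N) (1 + q^i) = C prod_(i <= N) (1 - q^i)] modulo
    [q^(N+1)], so Gauss' identity
      [prod (1 - q^i) / (1 + q^i) = 1 + 2 sum_(j >= 1) (-1)^j q^(j^2)]
    yields [D = (1 + 2 sum_(j >= 1) (-1)^j q^(j^2)) C]. The right-hand side is
    the generating function weighted by (-1)^((mex - 1) / 2): having
    (mex - 1) / 2 >= j means containing 1, 3, ..., 2j - 1 in color(k), and
    removing these parts lowers the size by j^2. Gauss' identity itself comes
    from Shanks' finite form, which holds exactly and telescopes in n. *)
Require Import Defs.
From mathcomp Require Import all_boot all_order all_algebra finmap multiset ring zify.

Set Implicit Arguments.
Unset Strict Implicit.
Unset Printing Implicit Defensive.

Import GRing.Theory Num.Theory.

Local Open Scope mset_scope.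
Local Open Scope nat_scope.
Local Open Scope ring_scope.

(** * Shanks' finite form of Gauss' identity *)

Definition shanks_term (R : comNzRingType) (q : R) (n s : nat) : R :=
  (-1) ^+ s * (\prod_(i < s) (1 + q ^+ i)) *
  (\prod_(s <= i < n) (1 - q ^+ i.+1)) * q ^+ (n.+1 * s).

Definition partial_theta (R : comNzRingType) (q : R) (n : nat) : R :=
  1 + \sum_(j < n) 2 * (-1) ^+ j.+1 * q ^+ (j.+1 ^ 2).

(** In [shanks_term] the quotient (q;q)_n / (q;q)_s is written as a product, so the induction on [n]
    needs no division. After telescoping, only the boundary value [U n.+1] and the new summand
    [s = n.+1] remain; together they form the next theta term times the product. *)
Lemma shanks_identity (R : comNzRingType) (q : R) (n : nat) :
  \sum_(s < n.+1) shanks_term q n s =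
  partial_theta q n * \prod_(i < n) (1 + q ^+ i.+1).
Proof.
rewrite /partial_theta; elim: n => [|n IHn].
  rewrite big_ord_recl !big_ord0 /shanks_term big_geq // big_ord0 expr0.
  by rewrite muln0 expr0; ring.
(* Witness for telescoping in s; U 0 = 0 because of the factor 1 - q^0. *)
pose U s : R := (-1) ^+ s * (\prod_(i < s) (1 + q ^+ i)) *
  (\prod_(s <= i < n.+1) (1 - q ^+ i)) * q ^+ (n.+1 * s).
have step (s : 'I_n.+1) : shanks_term q n.+1 s =
    (1 + q ^+ n.+1) * shanks_term q n s + (U s.+1 - U s).
  have sn : (s <= n)%N by rewrite -ltnS.
  rewrite /shanks_term /U big_ord_recr /=.
  rewrite [\prod_(s <= i < n.+1) (1 - q ^+ i)]big_ltn //.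
  rewrite big_nat_recr //= [\prod_(s.+1 <= i < n.+1) _]big_add1 /=.
  set a := \prod_(i < s) _; set b := \prod_(s <= i < n) _.
  have -> : (n.+2 * s = s + n.+1 * s)%N by lia.
  have -> : (n.+1 * s.+1 = n.+1 + n.+1 * s)%N by lia.
  by rewrite !exprD (exprS (-1) s); ring.
rewrite big_ord_recr /= (eq_bigr _ (fun s _ => step s)) big_split /= -mulr_sumr IHn.
have -> : \sum_(i < n.+1) (U i.+1 - U i) = U n.+1.
  rewrite -(big_mkord predT (fun i => U i.+1 - U i)) telescope_sumr //.
  by rewrite {2}/U big_ltn // expr0 subrr mul0r mulr0 mul0r subr0.
rewrite /U /shanks_term !big_geq //.
(* The factor at [i = 0] is the source of the coefficient 2 in the theta series. *)
have -> : \prod_(i < n.+1) (1 + q ^+ i) = 2 * \prod_(i < n) (1 + q ^+ i.+1).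
  by rewrite big_ord_recl expr0; congr (_ * _).
rewrite ![in RHS]big_ord_recr /=.
have -> : (n.+2 * n.+1 = n.+1 + n.+1 ^ 2)%N by rewrite expnS expn1; lia.
have -> : (n.+1 * n.+1 = n.+1 ^ 2)%N by [].
by rewrite exprD; ring.
Qed.

(* Modulo [q ^+ n.+1] only the term [s = 0] of Shanks' sum survives. *)
Lemma gauss_theta_mod (F : fieldType) (m n : nat) : (m <= n.+1)%N ->
  ('X^m : {poly F}) %| partial_theta 'X n * \prod_(i < n) (1 + 'X^(i.+1))
          - \prod_(i < n) (1 - 'X^(i.+1)).
Proof.
move=> mn; rewrite -shanks_identity big_ord_recl /=.
rewrite {1}/shanks_term big_ord0 muln0 !expr0 !mulr1 !mul1r big_mkord addrAC subrr add0r.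
elim/big_ind: _ => [||s _]; [exact: dvdp0 | exact: dvdp_add |].
 rewrite /shanks_term dvdp_mull // dvdp_exp2l //.
by rewrite /bump /=; nia.
Qed.

(** * Removing a fixed sub-multiset from colored partitions *)

Lemma perm_msetD (T : choiceType) (A B : {mset T}) :
  perm_eq (A `+` B) (enum_mset A ++ enum_mset B).
Proof.
by apply/allP => x _; rewrite /= count_cat !count_mem_mset msetE2.
Qed.

Lemma colored_partitionD (k m n : nat) (A B : {mset nat * 'I_k}) :
  colored_partition m A -> colored_partition (m + n) (A `+` B) = colored_partition n B.
Proof.
rewrite /colored_partition => /andP[A_gt0 /eqP sumA].
rewrite (perm_all _ (perm_msetD A B)) all_cat A_gt0 /=.
by rewrite (perm_big _ (perm_msetD A B)) big_cat /= sumA eqn_add2l.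
Qed.

Lemma colored_partition_sub (k m n : nat) (A l : {mset nat * 'I_k}) :
  colored_partition m A -> colored_partition n l -> A `<=` l -> (m <= n)%N.
Proof.
move=> /andP[_ /eqP <-] /andP[_ /eqP <-] /msetBDKC <-.
by rewrite (perm_big _ (perm_msetD _ _)) big_cat /= leq_addr.
Qed.

(** Adding [A] is a bijection from the partitions of [n] onto those of [m + n] that contain [A]. It
    serves both for [A] a single part and for [A] a staircase. *)
Lemma big_colored_partitions_sub (V : nmodType) (k m n : nat) (A : {mset nat * 'I_k})
    (P : pred {mset nat * 'I_k}) (F : {mset nat * 'I_k} -> V) :
  colored_partition m A ->
  \sum_(l <- colored_partitions k (m + n) | (A `<=` l) && P l) F l =
  \sum_(l <- colored_partitions k n | P (A `+` l)) F (A `+` l).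
Proof.
move=> mA; rewrite -big_filter_cond -(big_map (msetD A) P F); apply: perm_big.
apply: uniq_perm => [||l].
- by rewrite filter_uniq // fset_uniq.
- by rewrite map_inj_uniq ?fset_uniq //; apply/can_inj/msetDKB.
rewrite mem_filter colored_partitionsP; apply/andP/mapP => [[Al lP]|[l' l'P ->]].
  exists (l `\` A); last by rewrite msetBDKC.
  by rewrite colored_partitionsP -(@colored_partitionD _ m _ A) // msetBDKC.
rewrite colored_partitionsP in l'P; rewrite colored_partitionD //; split=> //.
by apply/msubsetP => x; rewrite msetE2 leq_addr.
Qed.

Lemma big_colored_partitions_sub0 (V : nmodType) (k m n : nat) (A : {mset nat * 'I_k})
    (P : pred {mset nat * 'I_k}) (F : {mset nat * 'I_k} -> V) :
  colored_partition m A -> (n < m)%N ->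
  \sum_(l <- colored_partitions k n | (A `<=` l) && P l) F l = 0.
Proof.
move=> mA nm; rewrite big_seq_cond big1 // => l /and3P[].
rewrite colored_partitionsP => ln Al _.
by have := colored_partition_sub mA ln Al; rewrite leqNgt nm.
Qed.

(** * Parts in the last color and their generating polynomials *)

Lemma perm_last_color_partsD (k : nat) (A B : {mset nat * 'I_k}) :
  perm_eq (last_color_parts (A `+` B)) (last_color_parts A ++ last_color_parts B).
Proof.
by rewrite /last_color_parts -map_cat -filter_cat perm_map // perm_filter // perm_msetD.
Qed.

(** With [k.+1] colors the last one has a name, [ord_max]. *)
Lemma mem_last_color_parts (k i : nat) (l : {mset nat * 'I_k.+1}) :
  (i \in last_color_parts l) = ((i, ord_max) \in l).
Proof.
apply/mapP/idP => [[[j c]]|il].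
  rewrite mem_filter /= eqSS => /andP[/eqP ck jl] ->.
  by rewrite (_ : ord_max = c) //; apply: val_inj.
by exists (i, ord_max); rewrite // mem_filter /= eqxx.
Qed.

Lemma last_color_parts1 (k i : nat) :
  last_color_parts [mset (i, ord_max : 'I_k.+1)] = [:: i].
Proof. by rewrite /last_color_parts enum_msetn /= eqxx. Qed.

(** Coefficients of C for [z = 1] and of D for [z = -1], once the parts up to [N] in the last color
    have been removed. *)
Definition avoiding_sum (R : pzRingType) (k : nat) (z : R) (N n : nat) : R :=
  \sum_(l <- colored_partitions k n | all (fun p => N < p)%N (last_color_parts l))
     z ^+ size (last_color_parts l).

Lemma avoiding_sum0 (R : pzRingType) (k : nat) (z : R) (n : nat) :
  avoiding_sum k.+1 z 0 n =
  \sum_(l <- colored_partitions k.+1 n) z ^+ size (last_color_parts l).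
Proof.
rewrite /avoiding_sum big_seq_cond [RHS]big_seq; apply: eq_bigl => l.
apply: andb_idr; rewrite colored_partitionsP => /andP[/allP l_gt0 _].
by apply/allP => i; rewrite mem_last_color_parts => /l_gt0.
Qed.

Lemma all_gtnS (N : nat) (s : seq nat) :
  all (fun p => N.+1 < p)%N s = (N.+1 \notin s) && all (fun p => N < p)%N s.
Proof.
elim: s => //= p s ->; rewrite inE negb_or.
by rewrite [(N.+1 < p)%N]ltn_neqAle; case: eqP => //= _; rewrite andbCA.
Qed.

Lemma avoiding_sumS (R : pzRingType) (k : nat) (z : R) (N n : nat) :
  avoiding_sum k.+1 z N n =
  avoiding_sum k.+1 z N.+1 n
  + (if (n < N.+1)%N then 0 else z * avoiding_sum k.+1 z N (n - N.+1)).
Proof.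
rewrite /avoiding_sum; pose a : {mset nat * 'I_k.+1} := [mset (N.+1, ord_max)].
have aP : colored_partition N.+1 a.
  by rewrite /colored_partition enum_msetn /= big_seq1 eqxx.
rewrite (bigID (fun l => a `<=` l)) /= addrC; congr (_ + _).
  apply: eq_bigl => l; rewrite all_gtnS andbC; congr (_ && _).
  by rewrite msub1set mem_last_color_parts.
under eq_bigl do rewrite andbC.
case: ltnP => [nN|Nn]; first exact: (big_colored_partitions_sub0 _ _ aP).
rewrite -{1}(subnKC Nn) big_colored_partitions_sub // mulr_sumr.
apply: eq_big => [l|l _].
  by rewrite (perm_all _ (perm_last_color_partsD _ _)) last_color_parts1 /= ltnSn.
by rewrite (perm_size (perm_last_color_partsD _ _)) last_color_parts1 /= exprS.
Qed.

(** A part of the last color would exceed [n], so there is none and every weight is [z ^+ 0]. *)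
Lemma avoiding_sum_ge (R : pzRingType) (k : nat) (z : R) (N n : nat) : (n <= N)%N ->
  avoiding_sum k z N n = avoiding_sum k 1 N n.
Proof.
move=> nN; rewrite /avoiding_sum big_seq_cond [RHS]big_seq_cond; apply: eq_bigr => l.
rewrite colored_partitionsP => /andP[/andP[_ /eqP sl] sN].
suff -> : last_color_parts l = [::] by [].
case E : (last_color_parts l) sN => [//|p s] /= /andP[Np _].
have: p \in last_color_parts l by rewrite E mem_head.
case/mapP => -[p' c]; rewrite mem_filter => /andP[_ /= xl] pE; subst p'.
by move: sl nN; rewrite (big_rem _ xl) /= => <-; lia.
Qed.

Lemma dvdXnP (F : fieldType) (m : nat) (p : {poly F}) :
  reflect (forall i, (i < m)%N -> p`_i = 0) ('X^m %| p).
Proof.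
apply: (iffP idP) => [/dvdpP[r ->] i im|p0]; first by rewrite coefMXn im.
rewrite -(poly_take_drop m p) (_ : take_poly m p = 0) ?add0r ?dvdp_mulIr //.
by apply/polyP => i; rewrite coef_take_poly coef0; case: ifP => // /p0.
Qed.

Definition avoiding_poly (R : nzRingType) (k : nat) (z : R) (m N : nat) : {poly R} :=
  \poly_(i < m) avoiding_sum k z N i.

(** Multiplying by [1 - z *: 'X^(i.+1)] is, coefficient by coefficient, the recurrence
    [avoiding_sumS]. *)
Lemma avoiding_poly_mod (F : fieldType) (k : nat) (z : F) (m N : nat) :
  'X^m %| \prod_(i < N) (1 - z *: 'X^(i.+1)) * avoiding_poly k.+1 z m 0
          - avoiding_poly k.+1 z m N.
Proof.
elim: N => [|N IHN]; first by rewrite big_ord0 mul1r subrr dvdp0.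
rewrite big_ord_recr /=.
set a := \prod_(i < N) _ in IHN *; set p := avoiding_poly _ _ _ _ in IHN *.
have -> : a * (1 - z *: 'X^(N.+1)) * p - avoiding_poly k.+1 z m N.+1 =
  (a * p - avoiding_poly k.+1 z m N) * (1 - z *: 'X^(N.+1)) +
  (avoiding_poly k.+1 z m N * (1 - z *: 'X^(N.+1)) - avoiding_poly k.+1 z m N.+1).
  by ring.
rewrite dvdp_add ?dvdp_mulr //; apply/dvdXnP => i im.
rewrite mulrBr mulr1 -scalerAr !coefB coefZ coefMXn !coef_poly im.
rewrite (avoiding_sumS k z N i); case: ltnP => _; first by rewrite mulr0 addr0 subr0 subrr.
by rewrite (leq_ltn_trans (leq_subr _ _) im); ring.
Qed.

Lemma avoiding_poly_theta (F : fieldType) (k n : nat) :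
  'X^(n.+1) %| avoiding_poly k.+1 (-1 : F) n.+1 0
               - partial_theta 'X n * avoiding_poly k.+1 1 n.+1 0.
Proof.
set D := avoiding_poly _ (-1) _ _; set C := avoiding_poly _ 1 _ _.
(* The product has constant term 1, so it can be cancelled modulo a power of ['X]. *)
have coprimeXn : coprimep ('X^(n.+1) : {poly F}) (\prod_(i < n) (1 + 'X^(i.+1))).
  apply: coprimep_expl; rewrite coprimep_sym -['X]subr0 coprimep_XsubC.
  rewrite /root horner_prod; apply/prodf_neq0 => i _.
  by rewrite !hornerE ?oppr0 expr0n addr0 oner_eq0.
rewrite -(Gauss_dvdpr _ coprimeXn).
have := avoiding_poly_mod k (-1 : F) n.+1 n; have := avoiding_poly_mod k (1 : F) n.+1 n.
(* Here the congruences for [z = 1] and [z = -1] meet: both now end in the same polynomial. *)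
have -> : avoiding_poly k.+1 (-1 : F) n.+1 n = avoiding_poly k.+1 1 n.+1 n.
  apply/polyP => i; rewrite !coef_poly ltnS; case: leqP => // iN.
  exact: avoiding_sum_ge.
under eq_bigr do rewrite scale1r.
under [X in _ -> _ %| X * _ - _ -> _]eq_bigr do rewrite scaleN1r opprK.
rewrite -/C -/D.
have := @gauss_theta_mod F _ n (leqnn _).
set th := partial_theta _ _; set a := \prod_(i < n) (1 + _); set b := \prod_(i < n) (1 - _).
set E := avoiding_poly _ _ _ _ => thE CE DE.
have -> : a * (D - th * C) = (a * D - E) - (b * C - E) - (th * a - b) * C by ring.
by apply: dvdp_sub; [apply: dvdp_sub | apply: dvdp_mulr].
Qed.

(** * Staircases of odd parts and the mex *)

Definition staircase (k j : nat) : {mset nat * 'I_k.+1} :=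
  seq_mset [seq (i.*2.+1, ord_max) | i <- iota 0 j].

Lemma staircase_partition (k j : nat) : colored_partition (j ^ 2) (staircase k j).
Proof.
rewrite /colored_partition (perm_all _ (perm_eq_seq_mset _)) (perm_big _ (perm_eq_seq_mset _)).
rewrite all_map big_map /=; apply/andP; split; first exact/allP.
apply/eqP; elim: j => [|j IHj]; first by rewrite big_nil.
by rewrite -addn1 iotaD cats1 big_rcons IHj /= -addnn; lia.
Qed.

Lemma staircase_sub (k j : nat) (l : {mset nat * 'I_k.+1}) :
  (staircase k j `<=` l) = all (fun i => i.*2.+1 \in last_color_parts l) (iota 0 j).
Proof.
have st_uniq : uniq [seq (i.*2.+1, ord_max : 'I_k.+1) | i <- iota 0 j].
  by rewrite map_inj_uniq ?iota_uniq // => x y [] /eqP; rewrite -!addnn => /eqP; lia.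
apply/msubsetP/allP => [sub i ij | st x].
  rewrite mem_last_color_parts in_mset; apply: leq_trans (sub _).
  by rewrite mset_seqE count_uniq_mem // map_f.
rewrite mset_seqE count_uniq_mem //; case: mapP => // -[i ij ->] /=.
by rewrite -in_mset -mem_last_color_parts st.
Qed.

Lemma mex21_odd (s : seq nat) : odd (mex21 s).
Proof.
rewrite /mex21; case: ex_minnP => m /and3P[_ /eqP + _] _.
by rewrite !modn2; case: (odd m).
Qed.

(** The mex is 2h + 1, where h counts the initial run of odd numbers present in [s]. A lower bound
    on h thus becomes containment of a staircase. *)
Lemma leq_half_mex21 (s : seq nat) (j : nat) :
  (j <= (mex21 s)./2)%N = all (fun i => i.*2.+1 \in s) (iota 0 j).
Proof.
have oddE := mex21_odd s; move: oddE; rewrite /mex21.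
case: ex_minnP => m /and3P[m_gt0 _ ms] m_min m_odd.
have mE : m = m./2.*2.+1 by rewrite -[LHS]odd_double_half m_odd.
apply/idP/allP => [jm i|st].
  rewrite mem_iota add0n => /andP[_ ij]; apply: contraLR (leq_trans ij jm) => is'.
  rewrite -leqNgt -leq_double -ltnS -mE m_min // /mex21_candidate is' andbT /=.
  by rewrite !modn2 /= odd_double.
rewrite leqNgt; apply/negP => mj; move/negP: ms; apply.
by rewrite mE st // mem_iota.
Qed.

Lemma mex21_mod4 (s : seq nat) :
  (mex21 s == 1 %[mod 4]) = ~~ odd (mex21 s)./2 /\
  (mex21 s == 3 %[mod 4]) = odd (mex21 s)./2.
Proof.
have mE : mex21 s = (mex21 s)./2.*2.+1 by rewrite -[LHS]odd_double_half mex21_odd.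
move: (_./2) mE => j ->; rewrite -[j]odd_double_half.
case: (odd j); rewrite oddD odd_double /=; split; apply/eqP; lia.
Qed.

(** This turns a sign into a sum over thresholds [j < h]. The range [n] does not depend on [h], so
    this sum can later be exchanged with the one over partitions. *)
Lemma sign_alternating_sum (R : comNzRingType) (n h : nat) : (h <= n)%N ->
  (-1) ^+ h = 1 + \sum_(j < n | (j < h)%N) 2 * (-1) ^+ j.+1 :> R.
Proof.
move=> hn; rewrite big_ord_narrow //=; elim: h {hn} => [|h IHh].
  by rewrite big_ord0 addr0.
by rewrite big_ord_recr /= addrA -IHh exprS; ring.
Qed.

(** A staircase of size h^2 fits into the partition, so h <= h^2 <= n. *)
Lemma half_mex21_le (k n : nat) (l : {mset nat * 'I_k.+1}) :
  colored_partition n l -> ((mex21 (last_color_parts l))./2 <= n)%N.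
Proof.
move=> ln; have := leqnn (mex21 (last_color_parts l))./2.
rewrite leq_half_mex21 -staircase_sub => /(colored_partition_sub (staircase_partition _ _) ln).
by apply: leq_trans; case: (_./2) => // h; rewrite expnS expn1 leq_pmulr.
Qed.

(** After the exchange of sums, threshold [j] selects the partitions containing [staircase k j.+1];
    removing it matches multiplication by ['X^(j.+1 ^ 2)]. *)
Lemma mex21_sign_sum (F : fieldType) (k n : nat) :
  \sum_(l <- colored_partitions k.+1 n) (-1) ^+ (mex21 (last_color_parts l))./2 =
  (partial_theta 'X n * avoiding_poly k.+1 1 n.+1 0)`_n :> F.
Proof.
have avoid0 m : avoiding_sum k.+1 1 0 m = \sum_(l <- colored_partitions k.+1 m) 1 :> F.
  by rewrite avoiding_sum0; apply: eq_bigr => l _; rewrite expr1n.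
rewrite /partial_theta mulrDl mul1r mulr_suml coefD coef_sum coef_poly ltnSn avoid0.
rewrite big_seq; under eq_bigr => l lP.
  rewrite colored_partitionsP in lP.
  rewrite (sign_alternating_sum _ (half_mex21_le lP)).
  rewrite (eq_bigl (fun j : 'I_n => staircase k j.+1 `<=` l)).
    over.
  by move=> j /=; rewrite leq_half_mex21 staircase_sub.
rewrite -big_seq big_split /=; congr (_ + _).
rewrite (exchange_big_dep predT) //=; apply: eq_bigr => j _.
have -> : 2 * (-1) ^+ j.+1 * 'X^(j.+1 ^ 2) = (2 * (-1) ^+ j.+1) *: 'X^(j.+1 ^ 2) :> {poly F}.
  by rewrite -mul_polyC polyCM polyC_natr polyC_exp polyCN.
set c := 2 * _; rewrite -scalerAl coefZ coefXnM coef_poly.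
rewrite (eq_bigr (fun=> c * 1)) => [|l _]; last by rewrite mulr1.
rewrite -mulr_sumr; congr (_ * _).
rewrite (eq_bigl (fun l => (staircase k j.+1 `<=` l) && predT l)); last first.
  by move=> l; rewrite andbT.
case: ltnP => nj; first by rewrite (big_colored_partitions_sub0 _ _ (staircase_partition _ _)).
rewrite ltnS leq_subr avoid0 -{1}(subnKC nj) big_colored_partitions_sub ?staircase_partition //.
Qed.

(** * From signed sums to counts *)

Lemma eq_count_sign (R : numDomainType) (T : Type) (s : seq T) (f g : T -> nat) :
  \sum_(x <- s) (-1) ^+ f x = \sum_(x <- s) (-1) ^+ g x :> R ->
  count (odd \o f) s = count (odd \o g) s.
Proof.
(* Each odd exponent lowers the sum by 2 from [size s]; characteristic zero then recovers the
   count. *)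
have sumE h : \sum_(x <- s) (-1) ^+ h x = (size s)%:R - 2 * (count (odd \o h) s)%:R :> R.
  elim: s => [|x s IHs] /=; first by rewrite big_nil mulr0 subr0.
  rewrite big_cons IHs -signr_odd natrD -[(size s).+1]add1n natrD.
  by case: (odd (h x)) => /=; ring.
rewrite !sumE => /addrI/oppr_inj/mulfI; rewrite pnatr_eq0 => /(_ isT)/eqP.
by rewrite eqr_nat => /eqP.
Qed.

Lemma card_fset_count (T : choiceType) (A : {fset T}) (P : pred T) :
  #|` [fset x in A | P x]%fset| = count P A.
Proof. by rewrite card_fset_sum1 big_fset sum1_count. Qed.

Local Close Scope ring_scope.

Theorem theorem1p1 (k n : nat) (hk : 1 <= k) :
  Ce k n = P21 n k /\ Co k n = P21bar n k.
Proof.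
case: k hk => // k _; rewrite /Ce /P21 /Co /P21bar !card_fset_count.
have odd_eq : count (fun l => odd (size (last_color_parts l))) (colored_partitions k.+1 n) =
    count (fun l => odd (mex21 (last_color_parts l))./2) (colored_partitions k.+1 n).
  (* [rat] is both a field, for divisibility of polynomials, and a numeric domain, for counting. *)
  apply: (@eq_count_sign rat); rewrite mex21_sign_sum -avoiding_sum0.
  have /dvdXnP/(_ n (ltnSn n))/eqP := avoiding_poly_theta rat k n.
  by rewrite coefB subr_eq0 coef_poly ltnSn => /eqP.
split; last first.
  by rewrite odd_eq; apply: eq_count => l; case: (mex21_mod4 (last_color_parts l)).
(* The even case follows by complement within the same set of partitions. *)
set C := enum_fset _ in odd_eq *.
rewrite [RHS](eq_count (a2 := predC (fun l => odd (mex21 (last_color_parts l))./2))); last first.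
  by move=> l; case: (mex21_mod4 (last_color_parts l)).
have := count_predC (fun l => odd (size (last_color_parts l))) C.
rewrite -(count_predC (fun l => odd (mex21 (last_color_parts l))./2) C) -odd_eq.
by move/addnI.
Qed.
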